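(* Let $k\ge 2$ and $q\ge1$ be integers, let $\Omega_1,\dots,\Omega_k$ be finite sets with $|\Omega_i|=q$, and let $\mu$ be a pairwise independent probability distribution on $\Omega_1\times\cdots\times\Omega_k$ whose marginals $\mu_i$ satisfy $\mu_i(x)>0$ for all $x\in\Omega_i$. Let $d$ be an integer, $\epsilon\ge 0$, and let $f_i\in L^2(\Omega_i^n,\mu_i^{\otimes n})$, $i=1,\dots,k$, satisfy $\|f_i\|_k\le 1$ and $\|f_i^{>d}\|_k\le\epsilon$ for all $i$. Then $$\left|\langle f_1,\dots,f_k\rangle_\mu-\langle f_1^{\le d},\dots,f_k^{\le d}\rangle_\mu\right|\le k\,\epsilon\,(1+\epsilon)^{k-1}.$$
   Context: Pairwise independence: for all $i<j$, $a\in\Omega_i$, $b\in\Omega_j$, $\Pr_{x\sim\mu}[x_i=a\wedge x_j=b]=\mu_i(a)\mu_j(b)$, where $\mu_i$ is the marginal of $\mu$ on $\Omega_i$. $L^2(\Omega_i^n,\mu_i^{\otimes n})$ is the space of functions $\Omega_i^n\to\mathbb{C}$ with inner product $\langle f,g\rangle=\mathbb{E}[f\overline g]$ and norms $\|f\|_p=(\mathbb{E}|f|^p)^{1/p}$ under the product measure $\mu_i^{\otimes n}$ (in particular $\|\cdot\|_k$ is the norm with $p=k$). Fourier basis: an orthonormal basis $\chi^i_0,\dots,\chi^i_{q-1}$ of $L^2(\Omega_i,\mu_i)$ with $\chi^i_0\equiv 1$. For $\sigma\in\mathbb{Z}_q^n$ put $\chi^i_\sigma(x_1,\dots,x_n)=\prod_{j=1}^n\chi^i_{\sigma_j}(x_j)$;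 these form an orthonormal basis of $L^2(\Omega_i^n,\mu_i^{\otimes n})$. For $f\in L^2(\Omega_i^n,\mu_i^{\otimes n})$ let $\hat f(\sigma)=\langle f,\chi^i_\sigma\rangle$, and let $|\sigma|$ be the number of coordinates $j$ with $\sigma_j\ne 0$. Then $f^{\le d}=\sum_{|\sigma|\le d}\hat f(\sigma)\chi^i_\sigma$ and $f^{>d}=\sum_{|\sigma|>d}\hat f(\sigma)\chi^i_\sigma$ (these do not depend on the choice of Fourier basis). Noisy inner product: $\langle f_1,\dots,f_k\rangle_\mu=\mathbb{E}_X\left[\prod_{i=1}^k f_i(X_i)\right]$, where $X$ is a random $k\times n$ matrix whose $n$ columns are i.i.d. samples from $\mu$, and $X_i\in\Omega_i^n$ is the $i$-th row of $X$. *)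

(* Defs.v *)
From HB Require Import structures.
From mathcomp Require Import all_boot all_order all_algebra.
From mathcomp Require Import reals exp.
From mathcomp Require Import complex.

Set Implicit Arguments.
Unset Strict Implicit.
Unset Printing Implicit Defensive.

Import Order.TTheory GRing.Theory Num.Theory.

Local Open Scope ring_scope.
Local Open Scope complex_scope.

Section FiniteProbability.
Variable R : realType.

Definition is_distribution (T : finType) (p : T -> R) : Prop :=
  (forall x, 0 <= p x) /\ \sum_x p x = 1.

Definition product_dist (T : finType) (p : T -> R) (n : nat)
    (x : {ffun 'I_n -> T}) : R :=
  \prod_(j < n) p (x j).

Definition expectation (T : finType) (p : T -> R) (f : T -> R[i]) : R[i] :=
  \sum_x (p x)%:C * f x.

Definition inner (T : finType) (p : T -> R) (f g : T -> R[i]) : R[i] :=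
  expectation p (fun x => f x * conjc (g x)).

Definition modulus (z : R[i]) : R := complex.Re `|z|.

Definition Lnorm (T : finType) (p : T -> R) (s : R) (f : T -> R[i]) : R :=
  (\sum_x p x * (modulus (f x) `^ s)) `^ s^-1.

End FiniteProbability.

Arguments product_dist {R T} p n x.

Section Fourier.
Variables (R : realType) (T : finType) (p : T -> R) (q : nat).

Definition fourier_basis (chi : 'I_q -> T -> R[i]) : Prop :=
  [/\ forall a b, inner p (chi a) (chi b) = (a == b)%:R,
      forall f : T -> R[i], exists c : 'I_q -> R[i],
        forall x, f x = \sum_a c a * chi a x
    & forall (a : 'I_q) x, a = 0%N :> nat -> chi a x = 1].

Variables (chi : 'I_q -> T -> R[i]) (n : nat).
Implicit Types (sigma : {ffun 'I_n -> 'I_q}) (f : {ffun 'I_n -> T} -> R[i]).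

Definition chi_prod sigma (x : {ffun 'I_n -> T}) : R[i] :=
  \prod_(j < n) chi (sigma j) (x j).

Definition weight sigma : nat := #|[set j | (sigma j : nat) != 0%N]|.

Definition fourier_coef f sigma : R[i] :=
  inner (product_dist p n) f (chi_prod sigma).

(* The cutoff is an integer: for d < 0 the low-degree part is zero. *)
Definition low_part (d : int) f (x : {ffun 'I_n -> T}) : R[i] :=
  \sum_(sigma : {ffun 'I_n -> 'I_q} | (weight sigma)%:Z <= d)
    fourier_coef f sigma * chi_prod sigma x.

Definition high_part (d : int) f (x : {ffun 'I_n -> T}) : R[i] :=
  \sum_(sigma : {ffun 'I_n -> 'I_q} | d < (weight sigma)%:Z)
    fourier_coef f sigma * chi_prod sigma x.

End Fourier.

Section Correlated.
Variables (R : realType) (k : nat) (Omega : 'I_k -> finType).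
Variable mu : {dffun forall i : 'I_k, Omega i} -> R.

Definition marginal (i : 'I_k) (a : Omega i) : R :=
  \sum_(x : {dffun forall i : 'I_k, Omega i} | x i == a) mu x.

Arguments marginal i a : clear implicits.

Definition pairwise_independent : Prop :=
  forall (i j : 'I_k), (i < j)%N -> forall (a : Omega i) (b : Omega j),
    \sum_(x : {dffun forall i : 'I_k, Omega i} | (x i == a) && (x j == b)) mu x
      = marginal i a * marginal j b.

(* A k x n matrix is encoded by its n columns, each a point of the product
   of the Omega i. *)
Definition matrix_row (n : nat)
    (X : {ffun 'I_n -> {dffun forall i : 'I_k, Omega i}}) (i : 'I_k) :
    {ffun 'I_n -> Omega i} :=
  [ffun j => X j i].

Definition noisy_inner (n : nat)
    (f : forall i : 'I_k, {ffun 'I_n -> Omega i} -> R[i]) : R[i] :=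
  expectation (product_dist mu n)
    (fun X => \prod_(i < k) f i (matrix_row X i)).

End Correlated.

Arguments marginal {R k Omega} mu i a.

(* Main.v *)
(* Replace the f_i by their low-degree parts one at a time. Each step changes
   the noisy inner product by one whose factors are low parts, one high part
   and unmodified functions. By Hölder's inequality with k factors of exponent
   k it is at most the product of the k-norms: eps for the high part, at most
   1 + eps for the others. Row i of the random matrix is distributed according
   to the n-fold product of the i-th marginal, so these norms are the given
   ones. *)

Require Import Defs.
From HB Require Import structures.
From mathcomp Require Import all_boot all_order all_algebra.
From mathcomp Require Import reals exp.
From mathcomp Require Import complex.

Set Implicit Arguments.
Unset Strict Implicit.
Unset Printing Implicit Defensive.

Import Order.TTheory GRing.Theory Num.Theory.

Local Open Scope ring_scope.
Local Open Scope complex_scope.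

(** * Hölder and Minkowski inequalities for weighted finite sums with integer exponent *)

Lemma prodr_le_mean_expr (R : realFieldType) (k : nat) (e : 'I_k -> R) :
  (0 < k)%N -> (forall i, 0 <= e i) ->
  \prod_i e i <= (\sum_i e i ^+ k) / k%:R.
Proof.
move=> k0 e0; have k0R : 0 < k%:R :> R by rewrite ltr0n.
(* After raising both sides to the power [k] this is AM-GM for the numbers [e i ^+ k], so no roots
   occur. *)
rewrite -(ler_pXn2r k0) ?nnegrE ?prodr_ge0 //; last first.
  by rewrite divr_ge0 ?ler0n // sumr_ge0 // => i _; rewrite exprn_ge0.
rewrite -prodrXl.
have [|+ _] := @leif_AGM R 'I_k predT (fun i => e i ^+ k).
  by move=> i _; rewrite exprn_ge0.
by rewrite cardT size_enum_ord.
Qed.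

(** Normalise each [g i] by [N i] and apply AM-GM pointwise; each of the [k] normalised power sums
    is at most 1, hence so is their mean. The bounds [N i] stand in for the norms, which keeps the
    statement free of roots. *)
Lemma holder_prod (R : realFieldType) (T : finType) (k : nat) (w : T -> R)
    (g : 'I_k -> T -> R) (N : 'I_k -> R) :
  (0 < k)%N -> (forall x, 0 <= w x) -> (forall i x, 0 <= g i x) ->
  (forall i, 0 <= N i) ->
  (forall i, \sum_x w x * g i x ^+ k <= N i ^+ k) ->
  \sum_x w x * \prod_i g i x <= \prod_i N i.
Proof.
move=> k0 w0 g0 N0 gN.
have wg0 i x : 0 <= w x * g i x ^+ k by rewrite mulr_ge0 ?exprn_ge0.
(* Normalising fails when some [N i] is 0; then [w x] or [g i x] vanishes at every [x], and the left
   side is 0. *)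
have [/existsP[i /eqP Ni0]|/existsPn Nn0] := boolP [exists i, N i == 0].
  rewrite big1 ?prodr_ge0 // => x _.
  have : \sum_x w x * g i x ^+ k == 0.
    rewrite eq_le sumr_ge0 ?andbT //.
    by have := gN i; rewrite Ni0 expr0n eqn0Ngt k0.
  rewrite psumr_eq0 // => /allP/(_ x (mem_index_enum _)) /=.
  rewrite mulf_eq0 expf_eq0 k0 /= (bigD1 i) //=.
  by case/orP=> /eqP ->; rewrite ?mul0r ?mulr0.
have Np i : 0 < N i by rewrite lt_neqAle eq_sym Nn0 N0.
have k0R : k%:R != 0 :> R by rewrite pnatr_eq0 -lt0n.
rewrite -[leRHS]mulr1 -ler_pdivrMl ?prodr_gt0 // mulr_sumr.
apply: (@le_trans _ _ (\sum_x w x * ((\sum_i (g i x / N i) ^+ k) / k%:R))).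
  apply: ler_sum => x _; rewrite mulrCA ler_wpM2l //.
  rewrite mulrC -prodf_div prodr_le_mean_expr // => i.
  by rewrite divr_ge0.
under eq_bigr do rewrite mulrA mulr_sumr.
rewrite -mulr_suml exchange_big /= ler_pdivrMr ?ltr0n // mul1r.
rewrite -[X in _ <= X%:R]card_ord -sum1_card natr_sum; apply: ler_sum => i _.
under eq_bigr do rewrite expr_div_n mulrA.
by rewrite -mulr_suml ler_pdivrMr ?exprn_gt0 // mul1r.
Qed.

(* Expanding the power, each mixed term is an instance of Hölder's
   inequality with k factors. *)
Lemma minkowski_expr (R : realFieldType) (T : finType) (k : nat) (w : T -> R)
    (a b : T -> R) (A B : R) :
  (0 < k)%N -> (forall x, 0 <= w x) ->
  (forall x, 0 <= a x) -> (forall x, 0 <= b x) -> 0 <= A -> 0 <= B ->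
  \sum_x w x * a x ^+ k <= A ^+ k -> \sum_x w x * b x ^+ k <= B ^+ k ->
  \sum_x w x * (a x + b x) ^+ k <= (A + B) ^+ k.
Proof.
move=> k0 w0 a0 b0 A0 B0 aA bB.
have mixed (S : comNzRingType) (x y : S) (i : 'I_k.+1) :
    x ^+ (k - i) * y ^+ i = \prod_(j < k) (if (j < i)%N then y else x).
  rewrite -(big_mkord predT (fun j => if (j < i)%N then y else x)).
  rewrite (@big_cat_nat _ _ _ i) //=; last by rewrite -ltnS.
  rewrite mulrC; congr (_ * _).
    rewrite big_nat (eq_bigr (fun=> y)); last by move=> j /andP[_ ->].
    by rewrite -big_nat prodr_const_nat subn0.
  rewrite big_nat (eq_bigr (fun=> x)); last first.
    by move=> j /andP[+ _]; rewrite ltnNge => ->.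
  by rewrite -big_nat prodr_const_nat.
rewrite exprDn; under eq_bigr do rewrite exprDn mulr_sumr.
rewrite exchange_big /=; apply: ler_sum => i _.
under eq_bigr do rewrite mulrnAr.
rewrite sumrMnl lerMn2r; apply/orP; right.
under eq_bigr do rewrite mixed.
rewrite mixed.
apply: (@holder_prod _ _ _ _ (fun (j : 'I_k) x => if (j < i)%N then b x else a x)
  (fun j => if (j < i)%N then B else A)) => // [j x|j|j];
  by case: (j < i)%N.
Qed.

Lemma prodrB_telescope (S : comNzRingType) (k : nat) (a b : 'I_k -> S) :
  \prod_j a j - \prod_j b j =
  \sum_(m < k) \prod_j (if j == m then a j - b j
                        else if (j < m)%N then b j else a j).
Proof.
(* Hybrid products: [h m] and [h m.+1] differ only in the factor at [m]. *)
pose h (m : nat) := \prod_(j < k) (if (j < m)%N then b j else a j).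
have -> : \prod_j a j = h 0%N by [].
have -> : \prod_j b j = h k by rewrite /h; apply: eq_bigr => j _; rewrite ltn_ord.
rewrite -[LHS]opprB -(telescope_sumr h (leq0n k)) big_mkord -sumrN.
apply: eq_bigr => m _; rewrite opprB /h.
rewrite (bigD1 m) //= ltnn [X in _ - X](bigD1 m) //= ltnSn.
rewrite [RHS](bigD1 m) //= eqxx mulrBl; congr (_ * _ - _ * _).
  by apply: eq_bigr => j /negbTE ->.
apply: eq_bigr => j jm; rewrite (negbTE jm) ltnS leq_eqVlt.
by rewrite [_ == _ :> nat](negbTE jm).
Qed.

Section Modulus.
Variable R : realType.
Implicit Types z : R[i].

Lemma modulusE z : (modulus z)%:C = `|z|.
Proof. by []. Qed.

Lemma modulus_ge0 z : 0 <= modulus z.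
Proof. by rewrite -lecR modulusE normr_ge0. Qed.

Lemma modulus_le_sum (I : finType) (F : I -> R[i]) :
  modulus (\sum_i F i) <= \sum_i modulus (F i).
Proof.
by rewrite -lecR modulusE rmorph_sum /=; apply: ler_norm_sum.
Qed.

Lemma modulus_prod (I : finType) (F : I -> R[i]) :
  modulus (\prod_i F i) = \prod_i modulus (F i).
Proof.
apply: complexI; rewrite modulusE normr_prod rmorph_prod.
exact: eq_bigr.
Qed.

Lemma modulusM_real (r : R) z : 0 <= r -> modulus (r%:C * z) = r * modulus z.
Proof.
move=> r0; apply: complexI; rewrite modulusE normrM rmorphM /= modulusE.
by rewrite ger0_norm // lecR.
Qed.

Lemma modulusB z z' : modulus (z - z') <= modulus z + modulus z'.
Proof. by rewrite -lecR rmorphD /= !modulusE ler_normB. Qed.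

End Modulus.

(** Passes from norms defined by real powers to the root-free form that the Hölder and Minkowski
    lemmas take. *)
Lemma sum_expr_le_Lnorm (R : realType) (T : finType) (p : T -> R) (k : nat)
    (f : T -> R[i]) (N : R) :
  (0 < k)%N -> (forall x, 0 <= p x) -> Lnorm p k%:R f <= N ->
  \sum_x p x * modulus (f x) ^+ k <= N ^+ k.
Proof.
rewrite /Lnorm => k0 p0 fN.
under eq_bigr do rewrite -powR_mulrn ?modulus_ge0 //.
set s := \sum_x _ in fN *.
have s0 : 0 <= s by apply: sumr_ge0 => x _; rewrite mulr_ge0 ?powR_ge0.
have -> : s = (s `^ k%:R^-1) ^+ k.
  by rewrite -powR_mulrn ?powR_ge0 // -powRrM mulVf ?powRr1 // pnatr_eq0 -lt0n.
by rewrite lerXn2r ?nnegrE ?powR_ge0 ?(le_trans (powR_ge0 _ _) fN).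
Qed.

(** * Fourier inversion on the product space *)

Section FourierInversion.
Variables (R : realType) (T : finType) (p : T -> R) (q : nat).
Variable chi : 'I_q -> T -> R[i].
Hypothesis chiP : fourier_basis p chi.

(** Completeness relation of the basis: it is the expansion of the indicator of [y], evaluated at
    [x]. *)
Lemma fourier_basis_complete x y :
  (p y)%:C * \sum_a chi a x * conjc (chi a y) = (x == y)%:R.
Proof.
have [orth span _] := chiP.
have [c cE] := span (fun z => (z == y)%:R).
have cb b : c b = (p y)%:C * conjc (chi b y).
  (* Orthonormality identifies [c b] with this inner product, in which only the point [y]
     contributes. *)
  transitivity (inner p (fun z => (z == y)%:R) (chi b)).
    rewrite /inner /expectation; under eq_bigr do rewrite cE mulr_suml mulr_sumr.
    rewrite exchange_big /= (eq_bigr (fun a => c a * (a == b)%:R)) => [|a _].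
      rewrite (bigD1 b) //= eqxx mulr1 big1 ?addr0 // => a /negbTE ->.
      by rewrite mulr0.
    rewrite -orth /inner /expectation mulr_sumr.
    by apply: eq_bigr => z _; rewrite -mulrA mulrCA.
  rewrite /inner /expectation (bigD1 y) //= eqxx mul1r big1 ?addr0 // => z.
  by move=> /negbTE ->; rewrite mul0r mulr0.
rewrite cE mulr_sumr; apply: eq_bigr => a _.
by rewrite cb -mulrA [_ * chi a x]mulrC.
Qed.

Lemma low_part_add_high_part (n : nat) (d : int)
    (f : {ffun 'I_n -> T} -> R[i]) x :
  low_part p chi d f x + high_part p chi d f x = f x.
Proof.
rewrite /low_part /high_part.
transitivity (\sum_s fourier_coef p chi f s * chi_prod chi s x).
  rewrite [RHS](bigID (fun s => (weight s)%:Z <= d)) /=; congr (_ + _).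
  by apply: eq_bigl => s; rewrite ltNge.
(* Unfolding the coefficients and swapping sums leaves a kernel in [x] and [y]. By distributivity it
   is a product over coordinates of the one-variable completeness relation. *)
transitivity (\sum_y f y * \prod_j (x j == y j)%:R).
  under eq_bigr do rewrite /fourier_coef /inner /expectation mulr_suml.
  rewrite exchange_big /=; apply: eq_bigr => y _.
  under [in RHS]eq_bigr do rewrite -fourier_basis_complete.
  rewrite big_split /= bigA_distr_bigA /= rmorph_prod.
  rewrite mulrCA !mulr_sumr; apply: eq_bigr => s _.
  rewrite /chi_prod rmorph_prod big_split /=.
  by rewrite -!mulrA; congr (_ * (_ * _)); rewrite mulrC.
rewrite (bigD1 x) //= big1 ?mulr1 => [|j _]; last by rewrite eqxx.
rewrite big1 ?addr0 // => y yx.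
have /existsP[j /negbTE xyj] : [exists j, x j != y j].
  apply: contraNT yx; rewrite negb_exists => /forallP xy.
  by apply/eqP/ffunP => j; apply/esym/eqP; have := xy j; rewrite negbK.
by rewrite (bigD1 j) //= xyj mul0r mulr0.
Qed.

End FourierInversion.

(** * Row distributions, and the Hölder bound for the noisy inner product *)

Section NoisyInner.
Variables (R : realType) (k n : nat) (Omega : 'I_k -> finType).
Variable mu : {dffun forall i : 'I_k, Omega i} -> R.

(** Group the matrices by their row [i]. Those with row [y] form a product set, column [j] ranging
    over the points with [i]-th entry [y j], so their total weight is a product of marginals. *)
Lemma sum_matrix_row (i : 'I_k) (h : {ffun 'I_n -> Omega i} -> R) :
  \sum_X product_dist mu n X * h (matrix_row X i) =
  \sum_y product_dist (marginal mu i) n y * h y.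
Proof.
rewrite (partition_big (fun X => matrix_row X i) predT) //=.
apply: eq_bigr => y _.
rewrite /product_dist /marginal bigA_distr_big_dep /= mulr_suml.
apply: eq_big => [X|X /eqP -> //].
apply/eqP/familyP => [<- j|Xy]; first by rewrite ffunE unfold_in.
by apply/ffunP => j; rewrite ffunE; have /eqP := Xy j.
Qed.

Hypothesis mu_ge0 : forall x, 0 <= mu x.
Hypothesis k_gt0 : (0 < k)%N.

Lemma modulus_noisy_inner_le (f : forall i, {ffun 'I_n -> Omega i} -> R[i])
    (N : 'I_k -> R) :
  (forall i, 0 <= N i) ->
  (forall i, \sum_y product_dist (marginal mu i) n y * modulus (f i y) ^+ k
             <= N i ^+ k) ->
  modulus (noisy_inner mu f) <= \prod_i N i.
Proof.
move=> N0 fN.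
have w0 X : 0 <= product_dist mu n X by apply: prodr_ge0.
apply: le_trans (modulus_le_sum _) _.
apply: (@le_trans _ _ (\sum_X product_dist mu n X *
    \prod_i modulus (f i (matrix_row X i)))).
  by apply: ler_sum => X _; rewrite modulusM_real // modulus_prod.
apply: (holder_prod (g := fun i X => modulus (f i (matrix_row X i)))) => //.
  by move=> i X; apply: modulus_ge0.
by move=> i; rewrite (sum_matrix_row (fun y => modulus (f i y) ^+ k)).
Qed.

Lemma noisy_innerB_telescope (f g : forall i, {ffun 'I_n -> Omega i} -> R[i]) :
  noisy_inner mu f - noisy_inner mu g =
  \sum_(m < k) noisy_inner mu (fun i y =>
    if i == m then f i y - g i y else if (i < m)%N then g i y else f i y).
Proof.
rewrite /noisy_inner /expectation -sumrB exchange_big /=.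
by apply: eq_bigr => X _; rewrite -mulrBr prodrB_telescope mulr_sumr.
Qed.

End NoisyInner.

Theorem proposition3p9 (R : realType) (k q n : nat)
  (hk : (2 <= k)%N) (hq : (1 <= q)%N)
  (Omega : 'I_k -> finType) (hOmega : forall i, #|Omega i| = q)
  (mu : {dffun forall i : 'I_k, Omega i} -> R)
  (hmu : is_distribution mu)
  (hpi : pairwise_independent mu)
  (hpos : forall (i : 'I_k) (a : Omega i), 0 < marginal mu i a)
  (chi : forall i : 'I_k, 'I_q -> Omega i -> R[i])
  (hchi : forall i, fourier_basis (marginal mu i) (chi i))
  (d : int) (eps : R) (heps : 0 <= eps)
  (f : forall i : 'I_k, {ffun 'I_n -> Omega i} -> R[i])
  (hf : forall i,
    Lnorm (product_dist (marginal mu i) n) k%:R (f i) <= 1)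
  (hfd : forall i,
    Lnorm (product_dist (marginal mu i) n) k%:R
      (high_part (marginal mu i) (chi i) d (f i)) <= eps) :
  modulus (noisy_inner mu f
           - noisy_inner mu
               (fun i => low_part (marginal mu i) (chi i) d (f i)))
    <= k%:R * eps * (1 + eps) ^+ k.-1.
Proof.
have [mu_ge0 _] := hmu; have k_gt0 : (0 < k)%N by apply: ltnW.
pose w i := product_dist (marginal mu i) n.
have w_ge0 i y : 0 <= w i y by apply: prodr_ge0 => j _; apply/ltW/hpos.
have f_le i := sum_expr_le_Lnorm k_gt0 (w_ge0 i) (hf i).
have high_le i := sum_expr_le_Lnorm k_gt0 (w_ge0 i) (hfd i).
have highE i y : high_part (marginal mu i) (chi i) d (f i) y =
    f i y - low_part (marginal mu i) (chi i) d (f i) y.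
  by rewrite -[in RHS](low_part_add_high_part (hchi i) d (f i)) addrAC subrr add0r.
have eps1_ge0 : 0 <= 1 + eps by rewrite addr_ge0.
have low_le i : \sum_y w i y *
    modulus (low_part (marginal mu i) (chi i) d (f i) y) ^+ k <= (1 + eps) ^+ k.
  have m_ge0 (F : {ffun 'I_n -> Omega i} -> R[i]) y : 0 <= modulus (F y).
    exact: (modulus_ge0 (F y)).
  (* The low part is [f i] minus the high part, so Minkowski with the bounds 1 and [eps] applies. *)
  apply: le_trans (minkowski_expr k_gt0 (w_ge0 i) (m_ge0 _) (m_ge0 _) ler01 heps
    (f_le i) (high_le i)).
  apply: ler_sum => y _; rewrite ler_wpM2l // lerXn2r ?nnegrE //.
  - by rewrite addr_ge0 ?m_ge0.
  - by apply: le_trans (modulusB _ _); rewrite highE opprB addrC subrK.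
rewrite noisy_innerB_telescope (le_trans (modulus_le_sum _)) //.
(* The factor [k] counts the telescoping steps; each is bounded separately. *)
rewrite -mulrA mulr_natl -[X in _ *+ X]card_ord -sumr_const.
apply: ler_sum => m _.
(* In step [m] the high part sits at index [m]; the other [k.-1] factors are low parts before [m]
   and original functions after it, for which the bound 1 is relaxed to [1 + eps]. *)
have -> : eps * (1 + eps) ^+ k.-1 = \prod_(i < k) (if i == m then eps else 1 + eps).
  rewrite (bigD1 m) //= eqxx; congr (_ * _).
  rewrite (eq_bigr (fun=> 1 + eps)) => [|i /negbTE -> //].
  by rewrite prodr_const cardC1 card_ord.
apply: modulus_noisy_inner_le => // i; first by case: ifP.
case: (i == m); first by under eq_bigr do rewrite -highE; apply: high_le.
case: (i < m)%N; first exact: low_le.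
apply: le_trans (f_le i) _; rewrite lerXn2r ?nnegrE //; by rewrite lerDl.
Qed.
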